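(* Let $\alpha,\beta>0$ and $b<c$. Let $V\in L^\infty(\mathbb{R})$ satisfy $V(x)\ge\alpha$ for a.e. $x\in(-\infty,b)\cup(c,\infty)$ and $V(x)=-\beta$ for $x\in(b,c)$. If $\sqrt{\beta}\,(c-b)\ge\pi$, then there exists $a\in[b,c]$ such that $F(a;V)=m(V)$.
   Context: Elements of $H^1(\mathbb{R})$ are identified with their continuous representatives; $\|u\|_\infty:=\|u\|_{L^\infty(\mathbb{R})}$. For $V\in L^\infty(\mathbb{R})$ and $u\in H^1(\mathbb{R})$ set $I(u;V):=\|u'\|_{L^2(\mathbb{R})}^2+\int_{\mathbb{R}}V|u|^2\,dx$ and $m(V):=\inf_{u\in H^1(\mathbb{R}),\,u\not\equiv0} I(u;V)/\|u\|_\infty^2$. For $a\in\mathbb{R}$, $K_a:=\{u\in H^1(\mathbb{R}):u(a)=\|u\|_\infty=1\}$ and $F(a;V):=\inf_{u\in K_a}I(u;V)$. *)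

(* Defs.v *)
From HB Require Import structures.
From mathcomp Require Import all_boot all_order all_algebra.
From mathcomp Require Import all_classical all_reals all_analysis.
Set Implicit Arguments. Unset Strict Implicit. Unset Printing Implicit Defensive.
Import Order.TTheory GRing.Theory Num.Theory.
Import numFieldNormedType.Exports.
Local Open Scope classical_set_scope.
Local Open Scope ring_scope.

Section Defs.
Variable R : realType.
Local Notation mu := (@lebesgue_measure R).

Definition L2 (f : R -> R) : Prop :=
  measurable_fun [set: R] f /\
  (\int[mu]_x ((f x) ^+ 2)%:E < +oo)%E.

Definition Linfty (V : R -> R) : Prop :=
  measurable_fun [set: R] V /\ exists M : R, {ae mu, forall x, `|V x| <= M}.

(* (u, g) : u is (the continuous representative of) an element of H^1(R)
   and g is (a representative of) its weak derivative u':
   u, g in L^2 and u(x) - u(y) = int_y^x g for all y <= x. *)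
Definition H1pair (u g : R -> R) : Prop :=
  L2 u /\ L2 g /\
  forall x y : R, y <= x -> ((u x - u y)%:E = \int[mu]_(t in `[y, x]) (g t)%:E)%E.

(* ||u||_oo for the continuous representative *)
Definition supnorm (u : R -> R) : R := sup [set `|u x| | x in [set: R]].

Definition Ifun (u g V : R -> R) : \bar R :=
  (\int[mu]_x ((g x) ^+ 2)%:E + \int[mu]_x (V x * (u x) ^+ 2)%:E)%E.

Definition mV (V : R -> R) : \bar R :=
  ereal_inf [set (Ifun ug.1 ug.2 V * ((supnorm ug.1) ^-2)%:E)%E
            | ug in [set ug : (R -> R) * (R -> R) |
                     H1pair ug.1 ug.2 /\ exists x, ug.1 x != 0]].

Definition FaV (a : R) (V : R -> R) : \bar R :=
  ereal_inf [set Ifun ug.1 ug.2 V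
            | ug in [set ug : (R -> R) * (R -> R) |
                     H1pair ug.1 ug.2 /\ ug.1 a = 1 /\ supnorm ug.1 = 1]].

End Defs.

(* Main.v *)
(* The competitor is built inside the well and keeps the function outside. Put
   w = sqrt beta and let v be in H^1 with |v| <= 1. On [b, c] replace v by the
   profile u that rises as a cosine of frequency w from |v b| to 1, stays equal
   to 1, and falls as a cosine from 1 to |v c|; outside, use v up to a sign on
   each side. Since w (c - b) >= pi, each cosine part has length at most
   pi / (2 w) <= (c - b) / 2, so u = 1 at the midpoint a of [b, c]. On the
   plateau the energy density -w^2 u^2 is minimal as |v| <= 1. On a cosine part
   attached at s, calibrate with th x = - k tan (k (x - s)): as
   th' = - k^2 - th^2, one has g^2 - k^2 v^2 = (g - th v)^2 + (th v^2)' for the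
   weak derivative g of v. Taking k < w avoids the pole of tan when v vanishes
   at an end of the well, and k -> w gives the energy of the cosine as a lower
   bound. Hence F(a; V) <= I(v; V), so F(a; V) <= m(V), while F(a; V) >= m(V)
   always holds. *)

Require Import Defs.
From HB Require Import structures.
From mathcomp Require Import all_boot all_order all_algebra.
From mathcomp Require Import all_classical all_reals all_analysis.
From mathcomp Require Import measurable_realfun ring lra.
Import Order.TTheory GRing.Theory Num.Theory.
Import numFieldNormedType.Exports.
Local Open Scope classical_set_scope.
Local Open Scope ring_scope.

(** * Square integrable functions *)

Section SquareIntegrable.
Context {R : realType}.
Local Notation mu := (@lebesgue_measure R).
Implicit Types (D E : set R) (f h : R -> R).

Definition intble D f := mu.-integrable D (EFin \o f).

Definition sqint D f := measurable_fun D f /\ intble D (fun x => f x ^+ 2).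

Lemma intbleS E D f : measurable E -> measurable D -> D `<=` E ->
  intble E f -> intble D f.
Proof. by move=> mE mD DE; rewrite /intble; exact: integrableS. Qed.

Lemma intble_measurable D f : intble D f -> measurable_fun D f.
Proof. by move=> /integrableP[/measurable_EFinP]. Qed.

Lemma intbleD D f h : measurable D -> intble D f -> intble D h ->
  intble D (fun x => f x + h x).
Proof.
by move=> mD iF ih; exact: (@integrableD _ _ _ mu D mD (EFin \o f) (EFin \o h)).
Qed.

Lemma intbleZ D k f : measurable D -> intble D f ->
  intble D (fun x => k * f x).
Proof. by move=> mD iF; exact: (@integrableZl _ _ _ mu D mD k (EFin \o f)). Qed.

Lemma intbleN D f : measurable D -> intble D f -> intble D (fun x => - f x).
Proof.
move=> mD iF; have := intbleZ D (-1) f mD iF; congr (intble _ _).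
by apply/funext => x; rewrite mulN1r.
Qed.

Lemma intbleB D f h : measurable D -> intble D f -> intble D h ->
  intble D (fun x => f x - h x).
Proof.
by move=> mD iF ih; apply: (intbleD D f (fun x => - h x)) => //; exact: intbleN.
Qed.

Lemma le_intble D f h : measurable D -> measurable_fun D f ->
  (forall x, D x -> `|f x| <= h x) -> intble D h -> intble D f.
Proof.
move=> mD mf fh; apply: (@le_integrable _ _ _ mu D mD _ (EFin \o h)) => //.
  exact/measurable_EFinP.
by move=> x Dx /=; rewrite lee_fin (le_trans (fh x Dx))// ler_norm.
Qed.

Lemma intble_norm D f : measurable D -> intble D f ->
  intble D (fun x => `|f x|).
Proof. by move=> mD iF; exact: (integrable_norm iF). Qed.

Lemma sqintS E D f : measurable E -> measurable D -> D `<=` E ->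
  sqint E f -> sqint D f.
Proof.
move=> mE mD DE [mf iF]; split; last exact: (intbleS E).
exact: (measurable_funS mE).
Qed.

Lemma sqintM D f h : measurable D -> sqint D f -> sqint D h ->
  intble D (fun x => f x * h x).
Proof.
move=> mD [mf iF] [mh ih].
apply: (le_intble _ _ (fun x => f x ^+ 2 + h x ^+ 2)) => //.
- exact: measurable_funM.
- move=> x _; rewrite normrM -(normr_id (f x)) -[f x ^+ 2]real_normK ?num_real//.
  rewrite -[h x ^+ 2]real_normK ?num_real// normr_id.
  have := sqr_ge0 (`|f x| - `|h x|).
  have := mulr_ge0 (normr_ge0 (f x)) (normr_ge0 (h x)).
  by rewrite sqrrB -mulr_natr; lra.
- exact: intbleD.
Qed.

Lemma sqintZ D k f : measurable D -> sqint D f -> sqint D (fun x => k * f x).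
Proof.
move=> mD [mf iF]; split; first exact: measurable_funM.
have := intbleZ D (k ^+ 2) _ mD iF; congr (intble _ _).
by apply/funext => x; rewrite exprMn.
Qed.

Lemma sqintD D f h : measurable D -> sqint D f -> sqint D h ->
  sqint D (fun x => f x + h x).
Proof.
move=> mD sf sh; split; first by apply: measurable_funD; [case: sf|case: sh].
have := intbleD _ _ _ mD (intbleD _ _ _ mD sf.2 sh.2)
  (intbleZ _ 2 _ mD (sqintM _ _ _ mD sf sh)).
congr (intble _ _); apply/funext => x; ring.
Qed.

Lemma sqint_bM D M f h : measurable D -> measurable_fun D f ->
  (forall x, D x -> `|f x| <= M) -> sqint D h ->
  sqint D (fun x => f x * h x).
Proof.
move=> mD mf fM [mh ih]; split; first exact: measurable_funM.
apply: (le_intble _ _ (fun x => M ^+ 2 * h x ^+ 2)) => //.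
- by apply: measurable_funX; exact: measurable_funM.
- move=> x Dx; rewrite normrX normrM exprMn [`|h x| ^+ 2]real_normK ?num_real//.
  apply: ler_wpM2r; first exact: sqr_ge0.
  by rewrite lerXn2r// ?nnegrE ?(le_trans _ (fM x Dx))// fM.
- exact: intbleZ.
Qed.

Lemma sqint_bounded D M f : measurable D -> (mu D < +oo)%E ->
  measurable_fun D f -> (forall x, D x -> `|f x| <= M) -> sqint D f.
Proof.
move=> mD Dfin mf fM.
have c1 : intble D (cst (M ^+ 2)).
  apply: measurable_bounded_integrable => //; exact: bounded_cst.
split => //; apply: (le_intble _ _ _ mD _ _ c1) => [|x Dx].
  exact: measurable_funX.
by rewrite normrX /= lerXn2r// ?nnegrE ?(le_trans _ (fM x Dx))// fM.
Qed.

Lemma sqint_intble D f : measurable D -> (mu D < +oo)%E -> sqint D f ->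
  intble D f.
Proof.
move=> mD Dfin sf.
have s1 : sqint D (cst 1).
  apply: (sqint_bounded D 1 _ mD Dfin) => [|x _]; last by rewrite normr1.
  exact: measurable_cst.
have := sqintM _ _ _ mD sf s1; congr (intble _ _).
by apply/funext => x; rewrite mulr1.
Qed.

End SquareIntegrable.

(** * Absolutely continuous functions with square integrable derivative *)

Section Primitives.
Context {R : realType}.
Local Notation mu := (@lebesgue_measure R).
Implicit Types (D E : set R) (f h u v g k : R -> R) (p q x y : R).

Lemma lebesgue_oc_lty y x : (mu `]y, x] < +oo)%E.
Proof. by rewrite lebesgue_measure_itv /=; case: ifP => // _; rewrite -EFinB ltry. Qed.

Lemma sub_oc p q y x : p <= y -> x <= q -> `]y, x] `<=` `]p, q].
Proof.
move=> py xq t /=; rewrite !in_itv /= => /andP[yt tx].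
by rewrite (le_lt_trans py yt) (le_trans tx xq).
Qed.

Lemma Rint_oc_split f p m q : intble `]p, q] f -> p <= m -> m <= q ->
  \int[mu]_(t in `]p, q]) f t =
  \int[mu]_(t in `]p, m]) f t + \int[mu]_(t in `]m, q]) f t.
Proof.
move=> iF pm mq; apply/eqP; rewrite addrC -subr_eq; apply/eqP.
by apply: Rintegral_itvB => //; rewrite ?bnd_simp.
Qed.

(* Both components are square integrable, which makes [ac2] stable under
   products; integrating over half-open intervals makes it stable under gluing
   without discarding null sets. *)
Definition ac2 p q u g :=
  [/\ sqint `]p, q] u, sqint `]p, q] g &
      forall y x, p <= y -> y <= x -> x <= q ->
        u x - u y = \int[mu]_(t in `]y, x]) g t].

Lemma ac2S p q y x u g : p <= y -> x <= q -> ac2 p q u g -> ac2 y x u g.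
Proof.
move=> py xq [su sg ug].
have sub := sub_oc _ _ _ _ py xq.
split; [exact: sqintS su|exact: sqintS sg|] => s t ys st tx.
by apply: ug => //; [exact: le_trans ys|exact: le_trans xq].
Qed.

Lemma ac2_intble p q u g : ac2 p q u g -> intble `]p, q] g.
Proof. by move=> [_ sg _]; apply: sqint_intble => //; exact: lebesgue_oc_lty. Qed.

(** The right-hand side is the total variation over all of []p, q]], hence uniform in s and t. It
    yields boundedness and also controls the error in the product rule. *)
Lemma ac2_variation p q u g s t : ac2 p q u g -> p <= s -> s <= t -> t <= q ->
  `|u t - u s| <= \int[mu]_(r in `]p, q]) `|g r|.
Proof.
move=> ug ps st tq; have ig := ac2_intble _ _ _ _ ug.
have ist : intble `]s, t] g by apply: intbleS ig => //; exact: sub_oc.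
have ing := intble_norm _ _ (measurable_itv _) ig.
case: (ug) => _ _ -> //.
apply: le_trans (le_normr_Rintegral _ ist) _ => //.
have pt := le_trans ps st; have sq := le_trans st tq.
rewrite (Rint_oc_split _ p s q ing ps sq).
rewrite (Rint_oc_split _ s t q _ st tq); last first.
  by apply: intbleS ing => //; exact: sub_oc.
by rewrite addrCA lerDl addr_ge0//; exact: Rintegral_ge0.
Qed.

Lemma ac2_bounded p q u g : ac2 p q u g ->
  exists M, forall x, p <= x -> x <= q -> `|u x| <= M.
Proof.
move=> ug; exists (`|u p| + \int[mu]_(r in `]p, q]) `|g r|) => x px xq.
have -> : u x = u p + (u x - u p) by ring.
apply: le_trans (ler_normD _ _) _; rewrite lerD2l.
exact: (ac2_variation p q u g).
Qed.

Lemma Rint_oc_cst c y x : y <= x -> \int[mu]_(t in `]y, x]) c = c * (x - y).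
Proof.
move=> yx; rewrite Rintegral_cst//; congr (_ * _).
rewrite [X in fine X](_ : _ = mu `]y, x])// lebesgue_measure_itv /= lte_fin.
case: ltP => //= xy; apply/eqP; rewrite eq_sym subr_eq0.
by rewrite eq_le xy yx.
Qed.

Lemma cauchy_schwarz_oc g y x : y <= x -> sqint `]y, x] g ->
  (\int[mu]_(t in `]y, x]) `|g t|) ^+ 2 <=
  (x - y) * \int[mu]_(t in `]y, x]) g t ^+ 2.
Proof.
rewrite le_eqVlt => /predU1P[<- _|yx sg].
  by rewrite set_itvoc0 !Rintegral_set0 expr0n mulr0.
have mD : measurable (`]y, x] : set R) by [].
have ig := intble_norm _ _ mD (sqint_intble _ _ mD (lebesgue_oc_lty _ _) sg).
set G := \int[mu]_(t in _) `|_|; set S := \int[mu]_(t in _) _.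
(* The mean of |g|: expanding the integral of (|g| - l)^2 >= 0 and multiplying by x - y gives the
   inequality. *)
pose l := G / (x - y).
have i1 : intble `]y, x] (cst (l ^+ 2)).
  apply: sqint_intble => //; first exact: lebesgue_oc_lty.
  apply: (sqint_bounded _ `|l ^+ 2|) => //; first exact: lebesgue_oc_lty.
have : 0 <= \int[mu]_(t in `]y, x]) (`|g t| - l) ^+ 2.
  by apply: Rintegral_ge0 => t _; exact: sqr_ge0.
have -> : (fun t => (`|g t| - l) ^+ 2) =
    (fun t => (g t ^+ 2 - (2 * l) * `|g t|) + (cst (l ^+ 2)) t).
  apply/funext => t; rewrite -[in RHS](real_normK (num_real (g t))) /=; ring.
rewrite RintegralD//; last by apply: intbleB => //; [exact: sg.2|exact: intbleZ].
rewrite RintegralB//; [|exact: sg.2|exact: intbleZ].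
rewrite RintegralZl// (Rint_oc_cst _ _ _ (ltW yx)) -/G -/S.
have xy0 : 0 < x - y by rewrite subr_gt0.
have lE : l * (x - y) = G by rewrite /l divfK// gt_eqF.
move=> /(mulr_ge0 (ltW xy0)) H.
rewrite -subr_ge0; apply: le_trans H _.
rewrite le_eqVlt; apply/orP; left; apply/eqP.
have -> : (x - y) * (S - 2 * l * G + l ^+ 2 * (x - y)) =
  (x - y) * S - 2 * (l * (x - y)) * G + (l * (x - y)) ^+ 2 by ring.
rewrite lE; ring.
Qed.

End Primitives.

(** * The product rule, by bisection *)

Section ProductRule.
Context {R : realType}.
Local Notation mu := (@lebesgue_measure R).
Implicit Types (u v g k : R -> R) (p q x y : R).

(** The error in the integrated product rule. It is shown to vanish from the integral formulas
    alone, without differentiating u or v at points. *)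
Definition leibniz_defect u g v k y x :=
  u x * v x - u y * v y - \int[mu]_(t in `]y, x]) (g t * v t + u t * k t).

Lemma ac2_leibniz_sqint p q u g v k : ac2 p q u g -> ac2 p q v k ->
  sqint `]p, q] (fun t => g t * v t + u t * k t).
Proof.
move=> ug vk.
have [M uM] := ac2_bounded _ _ _ _ ug; have [N vN] := ac2_bounded _ _ _ _ vk.
have [su sg _] := ug; have [sv sk _] := vk.
apply: sqintD => //.
- have -> : (fun t => g t * v t) = (fun t => v t * g t).
    by apply/funext => t; rewrite mulrC.
  apply: (sqint_bM _ N) => //; first by case: sv.
  by move=> x /=; rewrite in_itv /= => /andP[/ltW px xq]; exact: vN.
- apply: (sqint_bM _ M) => //; first by case: su.
  by move=> x /=; rewrite in_itv /= => /andP[/ltW px xq]; exact: uM.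
Qed.

Lemma leibniz_defect_split p q u g v k y m x : ac2 p q u g -> ac2 p q v k ->
  p <= y -> y <= m -> m <= x -> x <= q ->
  leibniz_defect u g v k y x =
  leibniz_defect u g v k y m + leibniz_defect u g v k m x.
Proof.
move=> ug vk py ym mx xq; rewrite /leibniz_defect.
rewrite (Rint_oc_split _ y m x)//; last first.
  apply: sqint_intble => //; first exact: lebesgue_oc_lty.
  by apply: ac2_leibniz_sqint; exact: ac2S ug || exact: ac2S vk.
ring.
Qed.

(** The defect is the integral of (v x - v t) g t - (u t - u y) k t, where the two differences are
    at most the total variations K and G. This gives 2 G K <= G^2 + K^2, and Cauchy-Schwarz supplies
    the factor x - y. *)
Lemma leibniz_defect_bound u g v k y x : y <= x ->
  ac2 y x u g -> ac2 y x v k ->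
  `|leibniz_defect u g v k y x| <=
  (x - y) * \int[mu]_(t in `]y, x]) (g t ^+ 2 + k t ^+ 2).
Proof.
move=> yx ug vk.
have [su sg uE] := ug; have [sv sk vE] := vk.
have mD : measurable (`]y, x] : set R) by [].
have ig := ac2_intble _ _ _ _ ug; have ik := ac2_intble _ _ _ _ vk.
have iga := intble_norm _ _ mD ig; have ika := intble_norm _ _ mD ik.
have il := sqint_intble _ _ mD (lebesgue_oc_lty _ _)
  (ac2_leibniz_sqint _ _ _ _ _ _ ug vk).
set G := \int[mu]_(t in `]y, x]) `|g t|.
set K := \int[mu]_(t in `]y, x]) `|k t|.
have -> : leibniz_defect u g v k y x =
    \int[mu]_(t in `]y, x]) (v x * g t + u y * k t - (g t * v t + u t * k t)).
  rewrite RintegralB//; last by apply: intbleD => //; exact: intbleZ.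
  rewrite RintegralD//; [|exact: intbleZ..].
  rewrite !RintegralZl// -uE// -vE// /leibniz_defect; ring.
have id : intble `]y, x]
    (fun t => v x * g t + u y * k t - (g t * v t + u t * k t)).
  by apply: intbleB => //; apply: intbleD => //; exact: intbleZ.
apply: le_trans (le_normr_Rintegral _ id) _ => //.
have : \int[mu]_(t in `]y, x])
    `|v x * g t + u y * k t - (g t * v t + u t * k t)| <=
    \int[mu]_(t in `]y, x]) (K * `|g t| + G * `|k t|).
  apply: le_Rintegral => //; first exact: intble_norm.
    by apply: intbleD => //; exact: intbleZ.
  move=> t /=; rewrite in_itv /= => /andP[/ltW yt tx].
  have -> : v x * g t + u y * k t - (g t * v t + u t * k t) =
    (v x - v t) * g t - (u t - u y) * k t by ring.
  apply: le_trans (ler_normB _ _) _; rewrite !normrM.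
  apply: lerD; apply: ler_wpM2r => //.
  - exact: (ac2_variation y x v k).
  - exact: (ac2_variation y x u g).
move/le_trans; apply.
rewrite RintegralD//; [|exact: intbleZ..].
rewrite !RintegralZl// -/G -/K RintegralD//; [|exact: sg.2|exact: sk.2].
rewrite mulrDr; apply: le_trans (lerD (cauchy_schwarz_oc g y x yx sg)
  (cauchy_schwarz_oc k y x yx sk)).
rewrite -/G -/K -subr_ge0.
have -> : G ^+ 2 + K ^+ 2 - (K * G + G * K) = (G - K) ^+ 2 by ring.
exact: sqr_ge0.
Qed.

(* The defect is additive and, on an interval of length l, at most l times an
   additive quantity; halving n times divides the bound by 2 ^ n. *)
Lemma leibniz_defect_halving u g v k n y x : y <= x ->
  ac2 y x u g -> ac2 y x v k ->
  `|leibniz_defect u g v k y x| <=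
  (x - y) * \int[mu]_(t in `]y, x]) (g t ^+ 2 + k t ^+ 2) / 2 ^+ n.
Proof.
elim: n y x => [|n IH] y x yx ug vk.
  by rewrite expr0 divr1; exact: leibniz_defect_bound.
pose m := (y + x) / 2.
have ym : y <= m by rewrite /m; lra.
have mx : m <= x by rewrite /m; lra.
rewrite (leibniz_defect_split _ _ _ _ _ _ _ m _ ug vk)//.
apply: le_trans (ler_normD _ _) _.
have H1 := IH y m ym (ac2S _ _ _ _ _ _ (lexx _) mx ug)
  (ac2S _ _ _ _ _ _ (lexx _) mx vk).
have H2 := IH m x mx (ac2S _ _ _ _ _ _ ym (lexx _) ug)
  (ac2S _ _ _ _ _ _ ym (lexx _) vk).
apply: le_trans (lerD H1 H2) _.
rewrite (Rint_oc_split _ y m x)//; last first.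
  by apply: intbleD => //; [case: ug => _ []|case: vk => _ []].
set A := \int[mu]_(t in `]y, m]) _; set B := \int[mu]_(t in _) _.
rewrite le_eqVlt; apply/orP; left; apply/eqP.
have -> : m - y = (x - y) / 2 by rewrite /m; field.
have -> : x - m = (x - y) / 2 by rewrite /m; field.
rewrite exprS; field.
by rewrite expf_neq0.
Qed.

Lemma leibniz_defect0 u g v k y x : y <= x ->
  ac2 y x u g -> ac2 y x v k -> leibniz_defect u g v k y x = 0.
Proof.
move=> yx ug vk; apply/normr0_eq0/eqP; rewrite eq_le normr_ge0 andbT.
set C := (x - y) * \int[mu]_(t in `]y, x]) (g t ^+ 2 + k t ^+ 2).
have H n : `|leibniz_defect u g v k y x| <= C / 2 ^+ n.
  exact: leibniz_defect_halving.
apply/ler_addgt0Pr => e e0; rewrite add0r.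
have C0 : 0 <= C.
  exact: le_trans (normr_ge0 _) (leibniz_defect_bound _ _ _ _ _ _ yx ug vk).
(* As 2^n > n, any n > C / e brings C / 2^n below e. *)
have [n nC] : exists n : nat, C / e < n%:R.
  by exists (Num.bound (C / e)); rewrite archi_boundP// divr_ge0// ltW.
apply: le_trans (H n) _.
rewrite ler_pdivrMr ?exprn_gt0// mulrC -ler_pdivrMr//.
apply: le_trans (ltW nC) _.
by rewrite -natrX ler_nat ltnW// ltn_expl.
Qed.

Lemma ac2M p q u g v k : ac2 p q u g -> ac2 p q v k ->
  ac2 p q (fun t => u t * v t) (fun t => g t * v t + u t * k t).
Proof.
move=> ug vk; split; last 1 first.
- move=> y x py yx xq.
  have := leibniz_defect0 u g v k y x yx (ac2S _ _ _ _ _ _ py xq ug)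
    (ac2S _ _ _ _ _ _ py xq vk).
  by rewrite /leibniz_defect => /eqP; rewrite subr_eq0 => /eqP.
- have [M uM] := ac2_bounded _ _ _ _ ug.
  apply: (sqint_bM _ M) => //; [by case: ug => -[]| |by case: vk].
  by move=> x /=; rewrite in_itv /= => /andP[/ltW px xq]; exact: uM.
- exact: ac2_leibniz_sqint.
Qed.

End ProductRule.

(** * Smooth functions and gluing *)

Section SmoothAndGluing.
Context {R : realType}.
Local Notation mu := (@lebesgue_measure R).
Implicit Types (D E : set R) (f h u v g k : R -> R) (p q x y : R).

(** Derivability of f' makes it continuous, hence square integrable on the compact interval and
    within reach of the fundamental theorem of calculus. *)
Lemma ac2_smooth p q f f' :
  (forall x, p <= x <= q -> is_derive x 1 f (f' x)) ->
  (forall x, p <= x <= q -> derivable f' x 1) ->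
  ac2 p q f f'.
Proof.
move=> df df'.
have cf : {within `[p, q], continuous f}.
  apply: derivable_within_continuous => x; rewrite in_itv /= => /df fx.
  exact: ex_derive.
have cf' : {within `[p, q], continuous f'}.
  by apply: derivable_within_continuous => x; rewrite in_itv /= => /df'.
have sub : (`]p, q] : set R) `<=` `[p, q] by exact: subset_itv_oc_cc.
have sq f0 : {within `[p, q], continuous f0} -> sqint `]p, q] f0.
  move=> c0; apply: (sqintS `[p, q]) => //.
  have i1 : intble `[p, q] f0.
    by apply: continuous_compact_integrable => //; exact: segment_compact.
  split; first exact: intble_measurable.
  apply: continuous_compact_integrable; first exact: segment_compact.
  by move=> x; apply: continuousM; exact: c0.
split; [exact: sq|exact: sq|] => y x py; rewrite le_eqVlt => /predU1P[->|yx] xq.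
  by rewrite subrr set_itvoc0 Rintegral_set0.
have din z : y <= z <= x -> is_derive z 1 f (f' z).
  by move=> /andP[yz zx]; apply: df; rewrite (le_trans py yz) (le_trans zx xq).
have sub' : (`[y, x] : set R) `<=` `[p, q].
  move=> z /=; rewrite !in_itv /= => /andP[yz zx].
  by rewrite (le_trans py yz) (le_trans zx xq).
have cf'' := continuous_subspaceW sub' cf'.
have cont z : y <= z <= x -> {for z, continuous f}.
  move=> /din fz; apply: differentiable_continuous; apply/derivable1_diffP.
  exact: ex_derive.
have := @continuous_FTC2 _ f' f y x yx cf''.
rewrite /Rintegral integral_itv_obnd_cbnd; last first.
  apply/measurable_EFinP; apply: (measurable_funS _ (sub_oc _ _ _ _ py xq)) => //.
  by case: (sq _ cf').
move=> -> //.
- split.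
  + move=> z; rewrite in_itv /= => /andP[yz zx].
    have fz : is_derive z 1 f (f' z) by apply: din; rewrite (ltW yz) (ltW zx).
    exact: ex_derive.
  + by apply: cvg_at_right_filter; apply: cont; rewrite lexx ltW.
  + by apply: cvg_at_left_filter; apply: cont; rewrite lexx ltW.
- move=> z; rewrite in_itv /= => /andP[yz zx].
  have fz : is_derive z 1 f (f' z) by apply: din; rewrite (ltW yz) (ltW zx).
  by rewrite derive1E; exact: derive_val.
Qed.

Lemma ac2_cst p q c : ac2 p q (cst c) (cst 0).
Proof. by apply: ac2_smooth => x _; exact: is_derive_cst || exact: derivable_cst. Qed.

Lemma sqint_eq D f h : measurable D -> (forall x, D x -> f x = h x) ->
  sqint D f -> sqint D h.
Proof.
move=> mD fh [mf iF]; split.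
  by apply: (eq_measurable_fun f) => // x; rewrite inE; exact: fh.
apply: (le_intble D _ (fun x => f x ^+ 2)) => // [|x /fh <-].
  apply: (eq_measurable_fun (fun x => f x ^+ 2)); last exact: measurable_funX.
  by move=> x; rewrite inE => /fh ->.
by rewrite ger0_norm ?sqr_ge0.
Qed.

Lemma sqintU D E f : measurable D -> measurable E -> [disjoint D & E] ->
  sqint D f -> sqint E f -> sqint (D `|` E) f.
Proof.
move=> mD mE DE [mfD iD] [mfE iE].
have mf : measurable_fun (D `|` E) f by apply/measurable_funU.
split => //; apply/integrableP.
have m2 : measurable_fun (D `|` E) (fun x => f x ^+ 2) by exact: measurable_funX.
split; first exact/measurable_EFinP.
rewrite ge0_integral_setU//; first last.
  by apply/measurable_EFinP; exact: measurableT_comp.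
by apply: lte_add_pinfty; [case/integrableP : iD|case/integrableP : iE].
Qed.

Lemma ac2_eq p q u v g k : (forall x, p <= x <= q -> u x = v x) ->
  (forall x, p < x <= q -> g x = k x) -> ac2 p q u g -> ac2 p q v k.
Proof.
move=> uv gk [su sg ug]; split.
- apply: sqint_eq su => // x /=; rewrite in_itv /= => /andP[/ltW px xq].
  by apply: uv; rewrite px.
- by apply: sqint_eq sg => // x /=; rewrite in_itv /=; exact: gk.
- move=> y x py yx xq; rewrite -!uv ?py ?xq ?(le_trans py yx) ?(le_trans yx xq)//.
  rewrite ug//; apply: eq_Rintegral => t; rewrite inE /= in_itv /= => /andP[yt tx].
  by apply: gk; rewrite (le_lt_trans py yt) (le_trans tx xq).
Qed.

(** The junction m belongs to the left piece, in line with the half-open intervals of [ac2]; so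
    derivatives can be glued without agreeing at m. *)
Definition glue m f h x := if x <= m then f x else h x.

Lemma glueL m f h x : x <= m -> glue m f h x = f x.
Proof. by rewrite /glue => ->. Qed.

Lemma glueR m f h x : m < x -> glue m f h x = h x.
Proof. by rewrite /glue leNgt => ->. Qed.

Lemma glueR_le m f h x : f m = h m -> m <= x -> glue m f h x = h x.
Proof.
by move=> fh; rewrite le_eqVlt => /predU1P[<-|]; [rewrite glueL|exact: glueR].
Qed.

Lemma ac2_glue p m q u1 g1 u2 g2 : p <= m -> m <= q -> u1 m = u2 m ->
  ac2 p m u1 g1 -> ac2 m q u2 g2 -> ac2 p q (glue m u1 u2) (glue m g1 g2).
Proof.
move=> pm mq um A1 A2.
have {}A1 : ac2 p m (glue m u1 u2) (glue m g1 g2).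
  by apply: ac2_eq A1 => x /andP[_ xm]; rewrite glueL.
have {}A2 : ac2 m q (glue m u1 u2) (glue m g1 g2).
  apply: ac2_eq A2 => x /andP[mx _]; first by rewrite glueR_le.
  by rewrite glueR.
move: (glue m u1 u2) (glue m g1 g2) A1 A2 => u g A1 A2 {um}.
have [[su1 sg1 ug1] [su2 sg2 ug2]] := (A1, A2).
have D : [disjoint (`]p, m] : set R) & `]m, q]].
  apply/disj_setPS => z /=; rewrite !in_itv /= => -[/andP[_ zm] /andP[mz _]].
  by have := lt_le_trans mz zm; rewrite ltxx.
have E : `]p, q]%classic = `]p, m] `|` `]m, q] :> set R.
  by apply: itv_bndbnd_setU; rewrite bnd_simp.
have sg : sqint `]p, q] g by rewrite E; exact: sqintU.
split => //; first by rewrite E; exact: sqintU.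
move=> y x py yx xq.
have [xm|mx] := leP x m; first exact: ug1.
have [my|ym] := leP m y; first exact: ug2.
have ig : intble `]y, x] g.
  apply: intbleS (sqint_intble _ _ _ (lebesgue_oc_lty _ _) sg) => //.
  exact: sub_oc.
(* Here y < m < x: the increment is the sum of those on either side of m. *)
rewrite (Rint_oc_split _ y m x ig (ltW ym) (ltW mx)).
rewrite -(ug1 y m py (ltW ym) (lexx _)) -(ug2 m x (lexx _) (ltW mx) xq); ring.
Qed.

End SmoothAndGluing.

(** * Energy in the well *)

Section WellEnergy.
Context {R : realType}.
Local Notation mu := (@lebesgue_measure R).
Implicit Types (u g : R -> R) (k w d p q s x : R).

(** The point s is the crest, where an arc joins the plateau. *)
Definition cosw k s x : R := cos (k * (x - s)).
Definition dcosw k s x : R := - (k * sin (k * (x - s))).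

Lemma is_derive_scaled k s x : is_derive x 1 (fun t => k * (t - s)) k.
Proof. by apply: is_derive_eq; rewrite subr0 /GRing.scale /= mulr1. Qed.

Lemma is_derive_cosw k s x : is_derive x 1 (cosw k s) (dcosw k s x).
Proof.
have := @is_derive1_comp _ cos (fun t => k * (t - s)) x _ _
  (is_derive_cos _) (is_derive_scaled k s x).
by rewrite /dcosw mulNr mulrC.
Qed.

Lemma is_derive_dcosw k s x :
  is_derive x 1 (dcosw k s) (- (k ^+ 2 * cosw k s x)).
Proof.
have H := @is_derive1_comp _ sin (fun t => k * (t - s)) x _ _
  (is_derive_sin _) (is_derive_scaled k s x).
apply: (is_derive_eq (is_deriveN (is_deriveZ k H))).
rewrite /GRing.scale /= /cosw; ring.
Qed.

Lemma ac2_cosw k s p q : ac2 p q (cosw k s) (dcosw k s).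
Proof.
apply: ac2_smooth => x _; first exact: is_derive_cosw.
by have H := is_derive_dcosw k s x; exact: ex_derive.
Qed.

Lemma ac2_dcosw k s p q :
  ac2 p q (dcosw k s) (fun x => - (k ^+ 2 * cosw k s x)).
Proof.
apply: ac2_smooth => x _; first exact: is_derive_dcosw.
have H := is_derive_cosw k s x.
have dc : derivable (cosw k s) x 1 by exact: ex_derive.
have -> : (fun x => - (k ^+ 2 * cosw k s x)) = - (k ^+ 2 \*: cosw k s) by [].
by apply: derivableN; exact: derivableZ.
Qed.

(** Since c'' = - k^2 c, the integrand is the derivative of c c', and only boundary terms remain. *)
Lemma cosw_energy k s p q : p <= q ->
  \int[mu]_(x in `]p, q]) (dcosw k s x ^+ 2 - k ^+ 2 * cosw k s x ^+ 2) =
  cosw k s q * dcosw k s q - cosw k s p * dcosw k s p.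
Proof.
move=> pq.
have [_ _ ->//] := ac2M _ _ _ _ _ _ (ac2_cosw k s p q) (ac2_dcosw k s p q).
apply: eq_Rintegral => x _; ring.
Qed.

(** The logarithmic derivative of [cosw k s], which solves the Riccati equation th' = - k^2 -
    th^2. *)
Definition tanw k s x : R := - (k * tan (k * (x - s))).

Lemma is_derive_tanw k s x : cos (k * (x - s)) != 0 ->
  is_derive x 1 (tanw k s) (- (k ^+ 2 + tanw k s x ^+ 2)).
Proof.
move=> c0.
have H := @is_derive1_comp _ tan (fun t => k * (t - s)) x _ _
  (is_derive_tan c0) (is_derive_scaled k s x).
apply: (is_derive_eq (is_deriveN (is_deriveZ k H))).
rewrite cos2_tan2// /GRing.scale /= /tanw; ring.
Qed.

(** The interval stays within one branch of the tangent, so th is smooth and the product rule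
    applies to th u^2. The energy density exceeds its derivative by (g - th u)^2. *)
Lemma calibration k s p q u g : p <= q ->
  (forall x, p <= x <= q -> - (pi / 2) < k * (x - s) < pi / 2) ->
  ac2 p q u g ->
  tanw k s q * u q ^+ 2 - tanw k s p * u p ^+ 2 <=
  \int[mu]_(x in `]p, q]) (g x ^+ 2 - k ^+ 2 * u x ^+ 2).
Proof.
move=> pq kpi ug.
have c0 x : p <= x <= q -> cos (k * (x - s)) != 0.
  by move=> /kpi /cos_gt0_pihalf /gt_eqF ->.
have th : ac2 p q (tanw k s) (fun x => - (k ^+ 2 + tanw k s x ^+ 2)).
  apply: ac2_smooth => x /c0 /is_derive_tanw H; first exact: H.
  have dt : derivable (tanw k s) x 1 by exact: ex_derive.
  have -> : (fun x => - (k ^+ 2 + tanw k s x ^+ 2)) =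
      - (cst (k ^+ 2) + tanw k s * tanw k s) by [].
  apply: derivableN; apply: derivableD; first exact: derivable_cst.
  exact: derivableM.
have uu := ac2M _ _ _ _ _ _ ug ug.
have thuu := ac2M _ _ _ _ _ _ th uu.
have [_ _ thE] := thuu; move: (thE p q (lexx _) pq (lexx _)).
rewrite !expr2 => ->.
have mD : measurable (`]p, q] : set R) by [].
apply: le_Rintegral => //; first exact: ac2_intble thuu.
  have [su sg _] := ug.
  by apply: intbleB => //; [exact: sg.2|apply: intbleZ => //; exact: su.2].
move=> x _; rewrite -subr_ge0.
apply: le_trans (sqr_ge0 (g x - tanw k s x * u x)) _.
by rewrite le_eqVlt; apply/orP; left; apply/eqP; ring.
Qed.

(** Strictness comes from k < w if d > 0, and from pi > 0 if d = 0. *)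
Lemma frequency_lt_pihalf k w d : k < w -> 0 <= d -> w * d <= pi / 2 ->
  k * d < pi / 2.
Proof.
move=> kw; rewrite le_eqVlt => /predU1P[<- _|d0 wd].
  by rewrite mulr0 divr_gt0// pi_gt0.
by apply: lt_le_trans wd; rewrite ltr_pM2r.
Qed.

(** Compares the boundary term of the calibration at distance d from the crest with that of the
    cosine of frequency w. The key inequality tan (k d) cos (w d) <= sin (w d) amounts to sin ((w -
    k) d) >= 0. *)
Lemma tan_le_sin_cos k w d a : 0 <= k -> k < w -> 0 <= d -> w * d <= pi / 2 ->
  `|a| <= cos (w * d) ->
  k * tan (k * d) * a ^+ 2 <= w * (sin (w * d) * cos (w * d)).
Proof.
move=> k0 kw d0 wd ad.
have pi0 := pi_gt0 R.
have kdwd : k * d <= w * d by apply: ler_wpM2r => //; exact: ltW.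
have kd0 : 0 <= k * d by exact: mulr_ge0.
have kdpi := frequency_lt_pihalf _ _ _ kw d0 wd.
have ckd : 0 < cos (k * d) by apply: cos_gt0_pihalf; rewrite kdpi andbT; lra.
have cwd : 0 <= cos (w * d) := le_trans (normr_ge0 _) ad.
have skd : 0 <= sin (k * d) by apply: sin_ge0_pi; rewrite kd0; lra.
have swd : 0 <= sin (w * d) by apply: sin_ge0_pi; rewrite (le_trans kd0 kdwd); lra.
have t0 : 0 <= tan (k * d) by rewrite /tan divr_ge0// ltW.
have a2 : a ^+ 2 <= cos (w * d) ^+ 2.
  by rewrite -(real_normK (num_real a)) lerXn2r// nnegrE.
have tcs : tan (k * d) * cos (w * d) <= sin (w * d).
  rewrite /tan mulrAC ler_pdivrMr// -subr_ge0.
  have -> : sin (w * d) * cos (k * d) - sin (k * d) * cos (w * d) =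
      sin (w * d - k * d) by rewrite sinB; ring.
  by apply: sin_ge0_pi; rewrite subr_ge0 kdwd; lra.
apply: le_trans (_ : k * tan (k * d) * cos (w * d) ^+ 2 <= _).
  by apply: ler_wpM2l => //; exact: mulr_ge0.
have -> : k * tan (k * d) * cos (w * d) ^+ 2 =
  k * (tan (k * d) * cos (w * d) * cos (w * d)) by ring.
apply: le_trans (_ : k * (sin (w * d) * cos (w * d)) <= _).
  by apply: ler_wpM2l => //; exact: ler_wpM2r.
by apply: ler_wpM2r; [exact: mulr_ge0|exact: ltW].
Qed.

Lemma le_limit_frequency (w A B U : R) : 0 < w -> 0 <= U ->
  (forall k, 0 <= k -> k < w -> B <= A - k ^+ 2 * U) -> B <= A - w ^+ 2 * U.
Proof.
move=> w0 U0 H; apply/ler_addgt0Pr => e e0.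
have W0 : 0 <= 2 * w ^+ 2 * U by rewrite mulr_ge0// mulr_ge0// sqr_ge0.
have eW : 0 < e + 2 * w ^+ 2 * U by exact: ltr_wpDr.
(* With k = w (1 - r), the loss (w^2 - k^2) U is at most 2 r w^2 U, hence at most e. The term e in
   the denominator keeps it positive when U = 0 and ensures r <= 1, so k >= 0. *)
pose r := e / (e + 2 * w ^+ 2 * U).
have r0 : 0 < r by exact: divr_gt0.
have r1 : r <= 1 by rewrite ler_pdivrMr// mul1r lerDl.
have rW : 2 * r * w ^+ 2 * U <= e.
  have -> : 2 * r * w ^+ 2 * U = r * (2 * w ^+ 2 * U) by ring.
  rewrite mulrAC ler_pdivrMr//; apply: ler_wpM2l; first exact: ltW.
  by rewrite lerDr ltW.
have k0 : 0 <= w * (1 - r) by apply: mulr_ge0; [exact: ltW|rewrite subr_ge0].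
have kw : w * (1 - r) < w by rewrite gtr_pMr// gtrBl.
apply: le_trans (H _ k0 kw) _.
have X : 0 <= r ^+ 2 * w ^+ 2 * U.
  by apply: mulr_ge0 => //; apply: mulr_ge0; exact: sqr_ge0.
have -> : (w * (1 - r)) ^+ 2 * U =
  w ^+ 2 * U - 2 * r * w ^+ 2 * U + r ^+ 2 * w ^+ 2 * U by ring.
lra.
Qed.

(** The lower bound is the energy of [cosw w s] itself on []p, q]]. Calibrating at k < w avoids the
    poles even when w (s - p) or w (q - s) equals pi / 2. *)
Lemma energy_lower_bound w s p q u g : 0 < w -> p <= s -> s <= q ->
  w * (s - p) <= pi / 2 -> w * (q - s) <= pi / 2 ->
  `|u p| <= cos (w * (s - p)) -> `|u q| <= cos (w * (q - s)) ->
  ac2 p q u g ->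
  - (w * (sin (w * (q - s)) * cos (w * (q - s))))
  - w * (sin (w * (s - p)) * cos (w * (s - p))) <=
  \int[mu]_(x in `]p, q]) (g x ^+ 2 - w ^+ 2 * u x ^+ 2).
Proof.
move=> w0 ps sq wp wq up uq ug.
have [su sg _] := ug.
have mD : measurable (`]p, q] : set R) by [].
have split k : \int[mu]_(x in `]p, q]) (g x ^+ 2 - k ^+ 2 * u x ^+ 2) =
    \int[mu]_(x in `]p, q]) g x ^+ 2 - k ^+ 2 * \int[mu]_(x in `]p, q]) u x ^+ 2.
  rewrite RintegralB//; [|exact: sg.2|apply: intbleZ => //; exact: su.2].
  by rewrite RintegralZl//; exact: su.2.
rewrite split; apply: le_limit_frequency => //.
  by apply: Rintegral_ge0 => x _; exact: sqr_ge0.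
move=> k k0 kw; rewrite -split.
have pi0 := pi_gt0 R.
have kpi x : p <= x <= q -> - (pi / 2) < k * (x - s) < pi / 2.
  move=> /andP[px xq]; apply/andP; split.
    rewrite ltrNl -mulrN opprB.
    have [sx|xs] := leP s x.
      apply: le_lt_trans (_ : 0 < _); last by lra.
      by rewrite -oppr_ge0 -mulrN opprB mulr_ge0// subr_ge0.
    apply: (frequency_lt_pihalf _ w) => //; first by rewrite subr_ge0 ltW.
    apply: le_trans wp; apply: ler_wpM2l; first exact: ltW.
    by rewrite lerD2l lerN2.
  have [sx|xs] := leP s x.
    apply: (frequency_lt_pihalf _ w) => //; first by rewrite subr_ge0.
    apply: le_trans wq; apply: ler_wpM2l; first exact: ltW.
    by rewrite lerD2r.
  apply: le_lt_trans (_ : 0 < _); last by lra.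
  by rewrite -oppr_ge0 -mulrN opprB mulr_ge0// subr_ge0 ltW.
apply: le_trans (calibration k s p q u g (le_trans ps sq) kpi ug).
rewrite /tanw mulNr; apply: lerB.
  by rewrite lerN2; apply: tan_le_sin_cos => //; rewrite subr_ge0.
have -> : k * (p - s) = - (k * (s - p)) by ring.
rewrite tanN mulrN opprK.
by apply: tan_le_sin_cos => //; rewrite subr_ge0.
Qed.

End WellEnergy.

(** * The competitor inside the well *)

Section Competitor.
Context {R : realType}.
Local Notation mu := (@lebesgue_measure R).
Implicit Types (u v g h : R -> R) (w b c t s x : R).

Lemma acos_le_pihalf t : 0 <= t -> t <= 1 -> acos t <= pi / 2.
Proof.
move=> t0 t1; have pi0 := pi_gt0 R.
have t11 : -1 <= t <= 1 by rewrite t1 andbT; lra.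
have [a0 cE] := acos_def t11; rewrite leNgt; apply/negP => at2.
have : cos (acos t) < cos (pi / 2).
  by rewrite ltr_cos// in_itv /= ?a0//; apply/andP; split; lra.
by rewrite cE cos_pihalf ltNge t0.
Qed.

(** Here d is the length of the arc descending from the crest to height t. *)
Lemma quarter_wave w t : 0 < w -> 0 <= t -> t <= 1 ->
  exists d, [/\ 0 <= d, w * d <= pi / 2 & cos (w * d) = t].
Proof.
move=> w0 t0 t1; exists (acos t / w).
have t11 : -1 <= t <= 1 by rewrite t1 andbT; lra.
have [/andP[a0 _] cE] := acos_def t11.
have -> : w * (acos t / w) = acos t by rewrite mulrC divfK// gt_eqF.
split => //; first by apply: divr_ge0 => //; exact: ltW.
exact: acos_le_pihalf.
Qed.

Definition well_energy w u g b c :=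
  \int[mu]_(x in `]b, c]) (g x ^+ 2 - w ^+ 2 * u x ^+ 2).

Lemma ac2_intble_energy w p q u g : ac2 p q u g ->
  intble `]p, q] (fun x => g x ^+ 2 - w ^+ 2 * u x ^+ 2).
Proof.
move=> [su sg _]; apply: intbleB => //; first exact: sg.2.
by apply: intbleZ => //; exact: su.2.
Qed.

Lemma well_energy_split w p m q u g : ac2 p q u g -> p <= m -> m <= q ->
  well_energy w u g p q = well_energy w u g p m + well_energy w u g m q.
Proof. by move=> ug; exact/Rint_oc_split/ac2_intble_energy. Qed.

Lemma eq_well_energy w p q u g v h :
  (forall x, p < x <= q -> u x = v x) -> (forall x, p < x <= q -> g x = h x) ->
  well_energy w u g p q = well_energy w v h p q.
Proof.
move=> uv gh; apply: eq_Rintegral => x; rewrite inE /= in_itv /= => px.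
by rewrite uv// gh.
Qed.

Lemma well_energy_cst1_le w p q v h : ac2 p q v h ->
  (forall x, `|v x| <= 1) ->
  well_energy w (cst 1) (cst 0) p q <= well_energy w v h p q.
Proof.
move=> vh v1; apply: le_Rintegral => //.
- exact: (ac2_intble_energy _ _ _ _ _ (ac2_cst p q 1)).
- exact: ac2_intble_energy.
- move=> x _ /=; apply: lerB; first by rewrite expr0n; exact: sqr_ge0.
  apply: ler_wpM2l; first exact: sqr_ge0.
  by rewrite -(real_normK (num_real (v x))) lerXn2r// nnegrE.
Qed.

(** Arcs of at most a quarter period reach only non-negative heights, so the ends match |v b| and |v
    c|; signs are dealt with when extending to the line. *)
Lemma well_competitor w b c v h : 0 < w -> pi <= w * (c - b) ->
  ac2 b c v h -> (forall x, `|v x| <= 1) ->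
  exists u g, [/\ ac2 b c u g, u ((b + c) / 2) = 1,
    forall x, `|u x| <= 1, u b = `|v b| /\ u c = `|v c| &
    well_energy w u g b c <= well_energy w v h b c].
Proof.
move=> w0 wbc vh v1.
have [d1 [d10 wd1 cd1]] := quarter_wave w _ w0 (normr_ge0 _) (v1 b).
have [d2 [d20 wd2 cd2]] := quarter_wave w _ w0 (normr_ge0 _) (v1 c).
have half d : w * d <= pi / 2 -> d <= (c - b) / 2.
  move=> wd; rewrite -(ler_pM2l w0); apply: le_trans wd _; lra.
have hd1 := half _ wd1; have hd2 := half _ wd2.
(* The crests of the two arcs. Each arc fills at most half the well, so s1 <= (b + c) / 2 <= s2 and
   the midpoint is on the plateau. *)
pose s1 := b + d1; pose s2 := c - d2.
have bs1 : b <= s1 by rewrite /s1; lra.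
have s12 : s1 <= s2 by rewrite /s1 /s2; lra.
have s2c : s2 <= c by rewrite /s2; lra.
have E1 : s1 - b = d1 by rewrite /s1; ring.
have E2 : c - s2 = d2 by rewrite /s2; ring.
pose u := glue s1 (cosw w s1) (glue s2 (cst 1) (cosw w s2)).
pose g := glue s1 (dcosw w s1) (glue s2 (cst 0) (dcosw w s2)).
have c1 s : cosw w s s = 1 by rewrite /cosw subrr mulr0 cos0.
have A2 : ac2 s1 c (glue s2 (cst 1) (cosw w s2)) (glue s2 (cst 0) (dcosw w s2)).
  apply: ac2_glue => //; [exact: ac2_cst|exact: ac2_cosw].
have ug : ac2 b c u g.
  apply: ac2_glue => //; [exact: le_trans s2c| |exact: ac2_cosw].
  by rewrite c1 glueL.
have ub : u b = `|v b|.
  rewrite /u glueL// -cd1 /cosw.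
  by rewrite -E1 -cosN; congr cos; ring.
have uR x : s1 <= x -> u x = glue s2 (cst 1) (cosw w s2) x.
  by apply: glueR_le; rewrite c1 glueL.
have uc : u c = `|v c|.
  by rewrite uR ?(le_trans s12)// glueR_le// -cd2 /cosw E2.
exists u, g; split => //.
- by rewrite uR ?glueL//; rewrite /s1 /s2; lra.
- by move=> x; rewrite /u /glue; case: ifP => _;
    [exact: cos_max|case: ifP => _; [rewrite normr1|exact: cos_max]].
have s1c := le_trans s12 s2c; have bs2 := le_trans bs1 s12.
have ug2 : ac2 s1 c u g by exact: ac2S ug.
have vh2 : ac2 s1 c v h by exact: ac2S vh.
rewrite (well_energy_split w b s1 c u g)// (well_energy_split w s1 s2 c u g)//.
rewrite (well_energy_split w b s1 c v h)// (well_energy_split w s1 s2 c v h)//.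
(* Rising arc, plateau and falling arc are compared separately. Each arc has its crest at an end of
   its interval, where the boundary term vanishes. *)
apply: lerD; last apply: lerD.
- rewrite (eq_well_energy w b s1 u g (cosw w s1) (dcosw w s1)); first last.
    by move=> x /andP[_ xs1]; rewrite /g glueL.
    by move=> x /andP[_ xs1]; rewrite /u glueL.
  rewrite /well_energy cosw_energy//.
  apply: le_trans (energy_lower_bound w s1 b s1 v h w0 bs1 (lexx _) _ _ _ _ _) => //.
  + rewrite c1 /cosw /dcosw !subrr !mulr0 cos0 sin0.
    have -> : w * (b - s1) = - (w * (s1 - b)) by ring.
    rewrite cosN sinN; lra.
  + by rewrite E1.
  + by rewrite subrr mulr0 divr_ge0// pi_ge0.
  + by rewrite E1 cd1.
  + by rewrite subrr mulr0 cos0.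
  + exact: ac2S vh.
- rewrite (eq_well_energy w s1 s2 u g (cst 1) (cst 0)); first last.
    by move=> x /andP[s1x xs2]; rewrite /g glueR// glueL.
    by move=> x /andP[s1x xs2]; rewrite /u glueR// glueL.
  by apply: well_energy_cst1_le => //; exact: ac2S vh.
- rewrite (eq_well_energy w s2 c u g (cosw w s2) (dcosw w s2)); first last.
    by move=> x /andP[s2x _]; rewrite /g !glueR// (le_lt_trans s12).
    by move=> x /andP[s2x _]; rewrite /u !glueR// (le_lt_trans s12).
  rewrite /well_energy cosw_energy//.
  apply: le_trans (energy_lower_bound w s2 s2 c v h w0 (lexx _) s2c _ _ _ _ _) => //.
  + rewrite c1 /cosw /dcosw !subrr !mulr0 cos0 sin0; lra.
  + by rewrite subrr mulr0 divr_ge0// pi_ge0.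
  + by rewrite E2.
  + by rewrite subrr mulr0 cos0.
  + by rewrite E2 cd2.
  + exact: ac2S vh.
Qed.

End Competitor.

(** * Functions of H^1(R) *)

Section SobolevFunctions.
Context {R : realType}.
Local Notation mu := (@lebesgue_measure R).
Implicit Types (u v g h V : R -> R) (w b c x y : R).

Lemma L2_sqint f : L2 f <-> sqint [set: R] f.
Proof.
split=> -[mf fin]; split => //.
  apply/integrableP; split; first exact/measurable_EFinP/measurable_funX.
  by under eq_integral do rewrite /= ger0_norm ?sqr_ge0//.
move/integrableP : fin => -[_].
by under eq_integral do rewrite /= ger0_norm ?sqr_ge0//.
Qed.

Lemma sqint_intble_cc f x y : sqint [set: R] f -> intble `[x, y] f.
Proof.
move=> sf; apply: sqint_intble => //; last by apply: (sqintS [set: R]).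
by rewrite lebesgue_measure_itv /=; case: ifP => // _; rewrite -EFinB ltry.
Qed.

(** Passes between the closed intervals of [H1pair] and the half-open ones of [ac2], which differ by
    a null set. *)
Lemma EFin_Rint_oc f y x : sqint [set: R] f ->
  (\int[mu]_(t in `]y, x]) f t)%:E = (\int[mu]_(t in `[y, x]) (f t)%:E)%E.
Proof.
move=> sf; have i := sqint_intble_cc f y x sf.
rewrite Rintegral_itv_obnd_cbnd; last first.
  by apply: (intbleS `[y, x]) i => //; exact: subset_itv_oc_cc.
by rewrite /Rintegral fineK//; exact: integrable_fin_num.
Qed.

Lemma H1pairP u g : H1pair u g <->
  [/\ sqint [set: R] u, sqint [set: R] g & forall p q, ac2 p q u g].
Proof.
split.
- move=> [/L2_sqint su [/L2_sqint sg ug]]; split=> // p q.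
  split; [exact: (sqintS [set: R])|exact: (sqintS [set: R])|] => y x _ yx _.
  by apply: EFin_inj; rewrite EFin_Rint_oc// ug.
- move=> [su sg ug]; split; [exact/L2_sqint|split; first exact/L2_sqint].
  move=> x y yx; have [_ _ ->//] := ug y x.
  exact: EFin_Rint_oc.
Qed.

Lemma ac2Z p q k u g : ac2 p q u g ->
  ac2 p q (fun x => k * u x) (fun x => k * g x).
Proof.
move=> ug; apply: ac2_eq (ac2M _ _ _ _ _ _ (ac2_cst p q k) ug) => // x _ /=.
by rewrite mul0r add0r.
Qed.

Lemma H1pairZ k u g : H1pair u g ->
  H1pair (fun x => k * u x) (fun x => k * g x).
Proof.
move=> /H1pairP[su sg ug]; apply/H1pairP; split; [exact: sqintZ..|] => p q.
exact: ac2Z.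
Qed.

Lemma sqint_setC D f : measurable D -> sqint D f -> sqint (~` D) f ->
  sqint [set: R] f.
Proof.
move=> mD fD fC; rewrite -(setUv D); apply: sqintU => //.
  exact: measurableC.
by rewrite /disj_set setICr.
Qed.

(** Near any x, on an interval of length one, u^2 is somewhere at most S + 1, and from there u
    varies by at most the integral of |g|, whose square is at most T. This makes the real supremum
    [supnorm] meaningful. *)
Lemma H1pair_bounded u g : H1pair u g -> exists M, forall x, `|u x| <= M.
Proof.
move=> /H1pairP[su sg ug].
pose S := \int[mu]_x u x ^+ 2; pose T := \int[mu]_x g x ^+ 2.
have le_all f p q : sqint [set: R] f ->
    \int[mu]_(t in `]p, q]) f t ^+ 2 <= \int[mu]_x f x ^+ 2.
  move=> sf; rewrite -(setUv `]p, q]%classic) Rintegral_setU//.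
  - by rewrite lerDl; apply: Rintegral_ge0 => t _; exact: sqr_ge0.
  - exact: measurableC.
  - by rewrite setUv; exact: sf.2.
  - by rewrite /disj_set setICr.
have S0 : 0 <= S by apply: Rintegral_ge0 => t _; exact: sqr_ge0.
have T0 : 0 <= T by apply: Rintegral_ge0 => t _; exact: sqr_ge0.
(* A crude bound that avoids square roots. *)
have le1 (z C : R) : 0 <= C -> z ^+ 2 <= C -> z <= C + 1.
  move=> C0 zC; rewrite leNgt; apply/negP => Cz.
  have := sqr_ge0 (z - 1); rewrite sqrrB1 -mulr_natr; lra.
exists (S + 2 + (T + 1)) => x.
have x1 : x - 1 <= x by lra.
(* Otherwise u^2 > S + 1 on an interval of length one, and its integral would exceed S. *)
have [y [xy yx uy]] : exists y, [/\ x - 1 <= y, y <= x & u y ^+ 2 <= S + 1].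
  apply: contrapT => H.
  have := le_all _ (x - 1) x su; apply/negP; rewrite -ltNge.
  apply: lt_le_trans (_ : S + 1 <= _); first by rewrite ltrDl.
  have -> : S + 1 = \int[mu]_(t in `]x - 1, x]) (cst (S + 1) t).
    by rewrite Rint_oc_cst//; ring.
  apply: le_Rintegral => //.
  - have [s1 _ _] := ac2_cst (x - 1) x (S + 1).
    by apply: sqint_intble => //; exact: lebesgue_oc_lty.
  - by apply: (intbleS [set: R]) => //; exact: su.2.
  - move=> t /=; rewrite in_itv /= => /andP[xt tx]; rewrite leNgt; apply/negP => tS.
    by apply: H; exists t; split => //; exact: ltW.
have ugx : ac2 (x - 1) x u g := ug _ _.
have -> : u x = u y + (u x - u y) by ring.
apply: le_trans (ler_normD _ _) (lerD _ _).
  have -> : S + 2 = S + 1 + 1 by ring.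
  by apply: le1; [exact: addr_ge0|rewrite real_normK// num_real].
apply: le_trans (ac2_variation _ _ _ _ y x ugx xy yx (lexx _)) _.
apply: le1 => //.
have [_ sgx _] := ugx.
apply: le_trans (cauchy_schwarz_oc g (x - 1) x x1 sgx) _.
have -> : x - (x - 1) = 1 by ring.
by rewrite mul1r; exact: le_all.
Qed.

Lemma norm_le_supnorm u g x : H1pair u g -> `|u x| <= supnorm u.
Proof.
move=> /H1pair_bounded[M uM]; apply: ub_le_sup; last by exists x.
by exists M => _ [y _ <-].
Qed.

Lemma supnorm_eq1 u x : (forall y, `|u y| <= 1) -> u x = 1 -> supnorm u = 1.
Proof.
move=> u1 ux; apply/eqP; rewrite eq_le; apply/andP; split.
  by apply: ge_sup => [|_ [y _ <-]//]; exists `|u x|, x.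
apply: ub_le_sup; last by exists x => //; rewrite ux normr1.
by exists 1 => _ [y _ <-].
Qed.

Lemma H1_competitor w b c v h : 0 < w -> b < c -> pi <= w * (c - b) ->
  H1pair v h -> (forall x, `|v x| <= 1) ->
  exists u g, [/\ H1pair u g, u ((b + c) / 2) = 1, forall x, `|u x| <= 1,
    forall x, ~ `]b, c]%classic x -> u x ^+ 2 = v x ^+ 2 /\ g x ^+ 2 = h x ^+ 2 &
    well_energy w u g b c <= well_energy w v h b c].
Proof.
move=> w0 bc wbc vhH v1.
have [sv sh vh] := (H1pairP v h).1 vhH.
have [u [g [ug ua u1 [ub uc] ule]]] :=
  well_competitor w b c v h w0 wbc (vh b c) v1.
(* The sign is 1 where v vanishes, so that its square is always 1 and squares are preserved outside
   the well. *)
pose sg x : R := if v x < 0 then -1 else 1.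
have sgE x : sg x * v x = `|v x|.
  by rewrite /sg; case: ltP => vx; [rewrite mulN1r ltr0_norm|rewrite mul1r ger0_norm].
have sg2 x : sg x ^+ 2 = 1 by rewrite /sg; case: ifP; rewrite ?sqrrN expr1n.
have sg1 x : `|sg x| <= 1 by rewrite /sg; case: ifP; rewrite ?normrN normr1.
pose U := glue b (fun x => sg b * v x) (glue c u (fun x => sg c * v x)).
pose G := glue b (fun x => sg b * h x) (glue c g (fun x => sg c * h x)).
(* Outside []b, c]] the glued functions are S v and S h; as S is bounded and measurable, square
   integrability carries over. *)
pose S x := if x <= b then sg b else sg c.
have S2 x : S x ^+ 2 = 1 by rewrite /S; case: ifP.
have S1 x : `|S x| <= 1 by rewrite /S; case: ifP.
have mS : measurable_fun [set: R] S.
  apply: measurable_fun_ifT; [|exact: measurable_cst..].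
  by apply: measurable_fun_ler; [exact: measurable_id|exact: measurable_cst].
have outE f f0 x : ~ `]b, c]%classic x ->
    glue b (fun x => sg b * f x) (glue c f0 (fun x => sg c * f x)) x = S x * f x.
  rewrite /S /glue /= in_itv /=; case: leP => //= bx /negP/negbTE ->//.
have inE' f f0 f1 x : b < x <= c -> glue b f1 (glue c f0 f) x = f0 x.
  by move=> /andP[bx xc]; rewrite glueR// glueL.
have sU f f0 : sqint [set: R] f -> sqint `]b, c] f0 ->
    sqint [set: R] (glue b (fun x => sg b * f x) (glue c f0 (fun x => sg c * f x))).
  move=> sf sf0; apply: (sqint_setC `]b, c]) => //.
    by apply: sqint_eq sf0 => // x /=; rewrite in_itv /= => xbc; rewrite inE'.
  have mC : measurable (~` `]b, c]%classic : set R) by exact: measurableC.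
  apply: (sqint_eq _ (fun x => S x * f x)) => // [x /outE ->//|].
  apply: (sqint_bM _ 1) => //; last exact: (sqintS [set: R]).
  exact: (measurable_funS measurableT).
have [su sg0 _] := ug.
exists U, G; split.
- apply/H1pairP; split; [exact: sU|exact: sU|] => p q.
  (* The interval is enlarged to contain both junctions b and c, then restricted back. *)
  have pp : Num.min p b <= p by rewrite ge_min lexx.
  have pb : Num.min p b <= b by rewrite ge_min lexx orbT.
  have qq : q <= Num.max q c by rewrite le_max lexx.
  have cq : c <= Num.max q c by rewrite le_max lexx orbT.
  apply: (ac2S (Num.min p b) (Num.max q c)) => //.
  apply: ac2_glue => //; first exact: le_trans (ltW bc) cq.
  + by rewrite glueL ?ltW// ub sgE.
  + exact/ac2Z.
  + by apply: ac2_glue => //; [exact: ltW|rewrite uc sgE|exact/ac2Z].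
- by rewrite /U inE'//; apply/andP; split; lra.
- move=> x; rewrite /U /glue; case: ifP => _; last case: ifP => // _.
    by rewrite normrM; apply: mulr_ile1.
  by rewrite normrM; apply: mulr_ile1.
- by move=> x xbc; rewrite /U /G !outE// !exprMn S2 !mul1r.
- rewrite (eq_well_energy w b c U G u g)// => x xbc.
    by rewrite /U inE'.
  by rewrite /G inE'.
Qed.

End SobolevFunctions.

(** * The energy on the whole line *)

Section Energy.
Context {R : realType}.
Local Notation mu := (@lebesgue_measure R).
Implicit Types (u v g h V : R -> R) (w b c x y : R).

(** One real integral in place of a sum of two extended ones, so that splitting the domain and
    scaling are ordinary algebra. *)
Definition energy V u g := \int[mu]_x (g x ^+ 2 + V x * u x ^+ 2).

Lemma Linfty_mul_intble V u : Linfty V -> sqint [set: R] u ->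
  intble [set: R] (fun x => V x * u x ^+ 2).
Proof.
move=> [mV [M VM]] [mu' iu].
have mf : measurable_fun [set: R] (fun x => V x * u x ^+ 2).
  by apply: measurable_funM => //; exact: measurable_funX.
(* The absolute value of M makes the dominating function non-negative everywhere, while |V| <= M is
   known only almost everywhere. *)
have mh : measurable_fun [set: R] (fun x => `|M| * u x ^+ 2).
  by apply: measurable_funM => //; exact: measurable_funX.
apply/integrableP; split; first exact/measurable_EFinP.
have iM := intbleZ _ `|M| _ measurableT iu.
apply: le_lt_trans (integrable_lty measurableT iM).
apply: ae_ge0_le_integral => //.
- by apply/measurable_EFinP; exact: measurableT_comp.
- by move=> x _; rewrite lee_fin mulr_ge0// sqr_ge0.
- exact/measurable_EFinP.
move: VM; apply: filterS; first exact: (ae_filter_ringOfSetsType mu).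
move=> x VxM _; rewrite /= lee_fin normrM.
rewrite (ger0_norm (sqr_ge0 (u x))); apply: ler_wpM2r; first exact: sqr_ge0.
exact: le_trans VxM (ler_norm _).
Qed.

Lemma intble_energy V u g : Linfty V -> H1pair u g ->
  intble [set: R] (fun x => g x ^+ 2 + V x * u x ^+ 2).
Proof.
move=> VL /H1pairP[su sg _]; apply: intbleD => //; first exact: sg.2.
exact: Linfty_mul_intble.
Qed.

Lemma Ifun_energy V u g : Linfty V -> H1pair u g ->
  Ifun u g V = (energy V u g)%:E.
Proof.
move=> VL ug; have /H1pairP[su sg _] := ug.
rewrite /energy /Rintegral fineK; last first.
  by apply: integrable_fin_num => //; exact: intble_energy.
apply: etrans (esym (integralD_EFin measurableT sg.2
  (Linfty_mul_intble _ _ VL su))) _.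
by apply: eq_integral => x _; rewrite /= EFinD.
Qed.

Lemma energyZ V k u g : Linfty V -> H1pair u g ->
  energy V (fun x => k * u x) (fun x => k * g x) = k ^+ 2 * energy V u g.
Proof.
move=> VL ug; rewrite /energy -RintegralZl//; last exact: intble_energy.
by apply: eq_Rintegral => x _; ring.
Qed.

Lemma energy_split V w b c u g : Linfty V -> H1pair u g -> b < c ->
  {ae mu, forall x, b < x < c -> V x = - w ^+ 2} ->
  energy V u g = well_energy w u g b c +
    \int[mu]_(x in ~` `]b, c]) (g x ^+ 2 + V x * u x ^+ 2).
Proof.
move=> VL ug bc Vw; have i := intble_energy _ _ _ VL ug.
have /H1pairP[su sg ugl] := ug.
rewrite /energy -(setUv `]b, c]%classic) Rintegral_setU//.
- congr (_ + _).
  have mbc : measurable (`]b, c] : set R) by [].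
  have i1 : intble `]b, c] (fun x => g x ^+ 2 + V x * u x ^+ 2).
    exact: (intbleS [set: R]).
  have i2 := ac2_intble_energy w _ _ _ _ (ugl b c).
  have sub : (`]b, c[ : set R) `<=` `]b, c] by exact: subset_itv_oo_oc.
  (* The value of V is prescribed on the open well, so the null endpoint c is dropped first. *)
  rewrite /well_energy -!Rintegral_itv_bndo_bndc; first last.
  + exact: (intbleS `]b, c]).
  + exact: (intbleS `]b, c]).
  congr fine; apply: ae_eq_integral => //.
  + apply/measurable_EFinP; exact: intble_measurable (intbleS _ _ _ mbc _ sub i1).
  + apply/measurable_EFinP; exact: intble_measurable (intbleS _ _ _ mbc _ sub i2).
  move: Vw; apply: filterS; first exact: (ae_filter_ringOfSetsType mu).
  move=> x Vx; rewrite /= in_itv /= => /Vx ->.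
  by rewrite mulNr.
- exact: measurableC.
- by rewrite setUv.
- by rewrite /disj_set setICr.
Qed.

End Energy.

(** * Comparison of the two infima *)

Theorem theorem5p6 (R : realType) (alpha beta b c : R) (V : R -> R) :
  0 < alpha -> 0 < beta -> b < c ->
  Linfty V ->
  {ae (@lebesgue_measure R), forall x, (x < b \/ c < x) -> alpha <= V x} ->
  {ae (@lebesgue_measure R), forall x, b < x < c -> V x = - beta} ->
  pi <= Num.sqrt beta * (c - b) ->
  exists2 a : R, b <= a <= c & FaV a V = mV V.
Proof.
move=> _ beta0 bc VL _ Vin wbc.
pose w := Num.sqrt beta.
have w0 : 0 < w by rewrite sqrtr_gt0.
have Vw : {ae (@lebesgue_measure R), forall x, b < x < c -> V x = - w ^+ 2}.
  by rewrite sqr_sqrtr// ltW.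
exists ((b + c) / 2); first by apply/andP; split; lra.
apply/eqP; rewrite eq_le; apply/andP; split; last first.
  (* F >= m: each competitor for F is one for m, with the same value because its sup norm is 1. *)
  apply: ereal_inf_le_tmp => _ [[u g] /= [ug [ua u1]] <-].
  exists (u, g) => /=.
    by split => //; exists ((b + c) / 2); rewrite ua oner_neq0.
  by rewrite u1 expr1n invr1 mule1.
apply: le_ereal_inf_tmp => _ [[u g] /= [ug [x0 ux0]] <-].
set N := supnorm u.
have uN x : `|u x| <= N by exact: norm_le_supnorm ug.
have N0 : 0 < N by apply: lt_le_trans (uN x0); rewrite normr_gt0.
(* F <= m: dividing by the sup norm N puts the function under the bound 1 required by the
   construction. *)
have vh := H1pairZ N^-1 _ _ ug.
have v1 x : `|N^-1 * u x| <= 1.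
  by rewrite normrM (gtr0_norm (_ : 0 < N^-1)) ?invr_gt0// ler_pdivrMl// mulr1.
have [U [G [UG Ua U1 Uout Uin]]] := H1_competitor w b c _ _ w0 bc wbc vh v1.
apply: le_trans (_ : Ifun U G V <= _)%E.
  apply: ereal_inf_lbound; exists (U, G) => //=; split => //; split => //.
  exact: supnorm_eq1 Ua.
rewrite !Ifun_energy// -EFinM lee_fin.
(* The quotient defining m is the energy of the normalised function, by homogeneity of degree
   two. *)
have -> : energy V u g * N ^- 2 =
    energy V (fun x => N^-1 * u x) (fun x => N^-1 * g x).
  by rewrite energyZ// mulrC exprVn.
rewrite !(energy_split V w b c)//; apply: lerD => //.
(* Outside []b, c]] the squares agree, so the two exterior integrals coincide. *)
rewrite le_eqVlt; apply/orP; left; apply/eqP.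
by apply: eq_Rintegral => x; rewrite inE => /Uout[-> ->].
Qed.
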